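(* Let $r\ge1$ and $\lambda\vdash r$. Then $$\sum_{|I|=r}\frac{\mathrm{Imm}_{\chi^\lambda}(X_I)}{\alpha(I)}=\frac{\mathrm{Imm}_{\chi^\lambda}(\Gamma_r)}{r!},$$ where the sum is over all non-decreasing multisets $I$ of $[m+n]$ of size $r$, the right-hand side is the classical immanant $\mathrm{Imm}_{\chi^\lambda}(M)=\sum_{\sigma\in\mathfrak{S}_r}\chi^\lambda(\sigma)\prod_{i=1}^rM_{i\sigma(i)}$ of a matrix with commuting entries, and $\Gamma_r$ is the $r\times r$ lower Hessenberg matrix with $(\Gamma_r)_{ij}=\gamma_{i-j+1}$ for $j\le i$, $(\Gamma_r)_{i,i+1}=i$, and $(\Gamma_r)_{ij}=0$ for $j>i+1$.
   Context: $\mathbb{C}^{m|n}$ has homogeneous basis $e_1,\ldots,e_{m+n}$, parity $\bar i=0$ for $i\le m$, $\bar i=1$ for $i>m$; $e_{ij}$ are matrix units of parity $\bar i+\bar j$. $\mathcal{A}$ is the free supercommutative $\mathbb{C}$-algebra on generators $x_{ij}$ of parity $\bar i+\bar j$; $X=\sum_{i,j}x_{ij}\otimes e_{ij}$. For $k\ge1$, $X_a=\sum_{i,j}x_{ij}\otimes1^{\otimes(a-1)}\otimes e_{ij}\otimes1^{\otimes(k-a)}\in\mathcal{A}\otimes\mathrm{End}(\mathbb{C}^{m|n})^{\otimes k}$ (graded tensor products, sign rule $(a\otimes b)(c\otimes d)=(-1)^{|b||c|}ac\otimes bd$). $\mathfrak{S}_k$ acts on $(\mathbb{C}^{m|n})^{\otimes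 k}$ by $\sigma\cdot(e_{i_1}\otimes\cdots\otimes e_{i_k})=(-1)^{\bar I_\sigma}e_{i_{\sigma^{-1}(1)}}\otimes\cdots\otimes e_{i_{\sigma^{-1}(k)}}$, $\bar I_\sigma=\sum_{p<q,\sigma(p)>\sigma(q)}\bar i_p\bar i_q$, extended to $\mathbb{C}[\mathfrak{S}_k]$ (even elements $1\otimes(\cdot)$); the transposition $(1\,2)$ acts on $(\mathbb{C}^{m|n})^{\otimes2}$ as $P=\sum_{i,j}(-1)^{\bar j}e_{ij}\otimes e_{ji}$. For even $T=\sum_{I,J}T^I_J\otimes e_{i_1j_1}\otimes\cdots\otimes e_{i_kj_k}$, $\langle I\mid T\mid J\rangle=(-1)^{\gamma(I,J)}T^I_J$, $\gamma(I,J)=\sum_a\bar i_a(\bar j_a+1)+\sum_{a<b}\bar j_b(\bar i_a+\bar j_a)$. Super-immanant: $\mathrm{Imm}_\chi(X_I)=(-1)^{\bar I}\langle I\mid\chi X_1\cdots X_k\mid I\rangle$ with $\bar I=\sum_p\bar i_p$ and the character $\chi$ identified with $\sum_\sigma\chi(\sigma)\sigma$; $\chi^\lambda$ is the irreducible character for $\lambda$. $\alpha(I)=\prod_i\alpha_i!$, $\alpha_i$ the multiplicity of $i$ in $I$. For even supermatrices $Y,Z\in\mathcal{A}\otimes\mathrm{End}(\mathbb{C}^{m|n})$, $Y*Z=\mathrm{str}_1(PY_1Z_2)$ with $Y_1=Y\otimes1$, $Z_2=1\otimes Z$ and $\mathrm{str}_1$ the partial supertrace ($\mathrm{str}(e_{ij})=\delta_{ij}(-1)^{\bar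 i}$) over the first factor; $X^{[1]}=X$, $X^{[k]}=X^{[k-1]}*X$, and $\gamma_k=\mathrm{str}\,X^{[k]}$. The $\gamma_k$ are even, hence lie in the commutative ring $\mathcal{A}_0$. *)

(* Defs.v *)
From HB Require Import structures.
From mathcomp Require Import all_boot all_order all_algebra all_fingroup all_field all_character.
Set Implicit Arguments. Unset Strict Implicit. Unset Printing Implicit Defensive.
Import GRing.Theory.
Local Open Scope ring_scope.

(* Base field C is modelled by algC. N = m + n basis vectors of C^{m|n}.   *)
Definition idx (N k : nat) := {ffun 'I_k -> 'I_N}.

(* parity of basis index i : 0 if i < m (i.e. i <= m 1-based), 1 otherwise *)
Definition par (m : nat) {N} (i : 'I_N) : nat := (m <= i)%N.
(* parity of the matrix unit e_ij *)
Definition pe (m : nat) {N} (i j : 'I_N) : nat := (par m i + par m j)%N.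

Section Tensors.
Variables (m : nat) (A : algType algC).
Local Notation sg k := ((-1 : A) ^+ k).

(* An even element T = \sum_{I,J} T^I_J (x) e_{i1 j1} (x) ... (x) e_{ik jk}  *)
(* of A (x) End(C^{m|n})^{(x)k} is represented by its coefficients T^I_J.    *)
Definition tens (N k : nat) := idx N k -> idx N k -> A.

(* product of even elements, from the graded sign rule                       *)
(* (a (x) u)(b (x) v) = (-1)^{|u||b|} ab (x) uv, |b| = |e_JL| for even S, and *)
(* e_IJ e_JL = (-1)^{sum_{a<b} |e_{i_b j_b}| |e_{j_a l_a}|} e_IL.             *)
Definition tsign {N k} (I J L : idx N k) : nat :=
  ((\sum_(a < k) pe m (I a) (J a)) * (\sum_(a < k) pe m (J a) (L a))
   + \sum_(a < k) \sum_(b < k | (a < b)%N) pe m (I b) (J b) * pe m (J a) (L a))%N.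

Definition tmul {N k} (T S : tens N k) : tens N k :=
  fun I L => \sum_(J : idx N k) sg (tsign I J L) * (T I J * S J L).

Definition tone {N k} : tens N k := fun I J => if I == J then 1 else 0.

(* X_a = sum x_ij (x) 1^{(a-1)} (x) e_ij (x) 1^{(k-a)}  (a is 0-based here) *)
Definition Xa {N k} (x : 'I_N -> 'I_N -> A) (a : 'I_k) : tens N k :=
  fun I J => if [forall b : 'I_k, (b != a) ==> (I b == J b)]
             then x (I a) (J a) else 0.

Definition Xprod {N k} (x : 'I_N -> 'I_N -> A) : tens N k :=
  \big[tmul/tone]_(a < k) Xa x a.

(* Action of sigma on (C^{m|n})^{(x)k}:                                      *)
(* sigma.(e_{j_1} (x)..(x) e_{j_k}) = (-1)^{J_sigma} e_{j_{s^-1 1}}(x)...     *)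
Definition inv_sign {N k} (s : 'S_k) (J : idx N k) : nat :=
  (\sum_(p < k) \sum_(q < k | (p < q)%N && (s q < s p)%N) par m (J p) * par m (J q))%N.

(* e_{i1 j1}(x)...(x)e_{ik jk} acts on e_L by delta_{JL}(-1)^{act_sign I J} e_I, *)
(* from (f (x) g)(v (x) w) = (-1)^{|g||v|} f v (x) g w.                          *)
Definition act_sign {N k} (I J : idx N k) : nat :=
  (\sum_(a < k) \sum_(b < k | (a < b)%N) pe m (I b) (J b) * par m (J a))%N.

(* coefficients of the operator sigma in the basis e_{IJ} (element 1 (x) sigma) *)
Definition sigmaT {N k} (s : 'S_k) : tens N k :=
  fun I J => if I == [ffun p => J ((s^-1)%g p)]
             then sg (inv_sign s J + act_sign I J) else 0.

Definition chiT {N k} (chi : 'S_k -> algC) : tens N k :=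
  fun I J => \sum_(s : 'S_k) chi s *: sigmaT s I J.

Definition gamma_sign {N k} (I J : idx N k) : nat :=
  (\sum_(a < k) par m (I a) * (par m (J a) + 1)
   + \sum_(a < k) \sum_(b < k | (a < b)%N) par m (J b) * pe m (I a) (J a))%N.

Definition bra_ket {N k} (I : idx N k) (T : tens N k) (J : idx N k) : A :=
  sg (gamma_sign I J) * T I J.

Definition superImm {N k} (x : 'I_N -> 'I_N -> A) (chi : 'S_k -> algC)
  (I : idx N k) : A :=
  sg (\sum_(p < k) par m (I p))%N * bra_ket I (tmul (chiT chi) (Xprod x)) I.

Definition alpha {N k} (I : idx N k) : nat :=
  (\prod_(i : 'I_N) (#|[set a : 'I_k | I a == i]|)`!)%N.

Definition nondecr {N k} (I : idx N k) : bool :=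
  [forall a : 'I_k, forall b : 'I_k, (a <= b)%N ==> (I a <= I b)%N].

(* even supermatrices Y = sum Y_ij (x) e_ij, given by coefficients *)
Definition smat (N : nat) := 'I_N -> 'I_N -> A.

Definition pair2 {N} (i j : 'I_N) : idx N 2 := [ffun a : 'I_2 => if a == ord0 then i else j].

Definition Y1 {N} (Y : smat N) : tens N 2 :=
  fun I J => if I (1 : 'I_2) == J (1 : 'I_2) then Y (I ord0) (J ord0) else 0.
Definition Z2 {N} (Z : smat N) : tens N 2 :=
  fun I J => if I ord0 == J ord0 then Z (I (1 : 'I_2)) (J (1 : 'I_2)) else 0.
(* P = sum_{i,j} (-1)^{j} e_ij (x) e_ji *)
Definition PT {N} : tens N 2 :=
  fun I J => if (I ord0 == J (1 : 'I_2)) && (I (1 : 'I_2) == J ord0)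
             then sg (par m (I (1 : 'I_2))) else 0.

(* Y * Z = str_1 (P Y_1 Z_2) *)
Definition sstar {N} (Y Z : smat N) : smat N :=
  fun i j => \sum_(l : 'I_N) sg (par m l) *
               tmul (tmul PT (Y1 Y)) (Z2 Z) (pair2 l i) (pair2 l j).

(* Xpow k = X^{[k+1]} *)
Fixpoint Xpow {N} (X : smat N) (k : nat) : smat N :=
  if k is k'.+1 then sstar (Xpow X k') X else X.

Definition sstr {N} (Y : smat N) : A := \sum_(i : 'I_N) sg (par m i) * Y i i.

(* gamma_k = str X^{[k]}, k >= 1 *)
Definition gam {N} (X : smat N) (k : nat) : A := sstr (Xpow X k.-1).

(* Gamma_r (0-based indices; same entries as the 1-based description) *)
Definition Gamma {N} (X : smat N) (r : nat) : 'M[A]_r :=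
  \matrix_(i < r, j < r)
    if (j <= i)%N then gam X (i - j + 1)
    else if j == i.+1 :> nat then (i.+1)%:R else 0.

Definition immanant {r} (chi : 'S_r -> algC) (M : 'M[A]_r) : A :=
  \sum_(s : 'S_r) chi s *: \prod_(i < r) M i (s i).

End Tensors.

(* Main.v *)
(*
   The sum over sorted multi-indices becomes (1/r!) times a sum over all of
   them, because the super-immanant does not change when I is permuted and
   alpha I permutations sort I.  Hence the left-hand side is
   (1/r!) sum_s chi(s) F(s), where F(s) is the supertrace of s X_1 ... X_r,
   and s |-> chi(s) F(s) is a class function.

   For any class function G on S_r, sum_s G(s) equals the sum over Hessenberg
   permutations (s(i) <= i+1) of G(s) weighted by the superdiagonal entries of
   Gamma_r: treating k = r, r-1, ..., whenever s^-1(k) < k one may conjugate by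
   a transposition fixing k, ..., r to get s(k-1) = k, with k-1 choices for
   s^-1(k).

   A Hessenberg permutation is a direct sum of cycles on consecutive intervals,
   and there F(s) factors over the intervals: summing out the indices one at a
   time turns each interval of length l into
   sum_j (-1)^j (M^l)_jj = gamma_l with M the transpose of X.
*)
Require Import Defs.
From HB Require Import structures.
From mathcomp Require Import all_boot all_order all_algebra all_fingroup all_field all_character.
From mathcomp Require Import zify.
Set Implicit Arguments. Unset Strict Implicit. Unset Printing Implicit Defensive.
Import GRing.Theory.
Local Open Scope ring_scope.

(** * The super-immanant as a signed sum of monomials *)

Lemma sign_congr (A : pzRingType) (a b : nat) :
  odd a = odd b -> (-1 : A) ^+ a = (-1) ^+ b.
Proof. by move=> e; rewrite -[LHS]signr_odd e signr_odd. Qed.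

Lemma scaler_sign (A : algType algC) (a : algC) (k : nat) (y : A) :
  (-1) ^+ k * (a *: y) = a *: ((-1) ^+ k * y).
Proof. by rewrite scalerAr. Qed.

Lemma odd_pe (m N : nat) (i j : 'I_N) :
  odd (pe m i j) = odd (par m i) (+) odd (par m j).
Proof. by rewrite oddD. Qed.

Lemma odd_pe_id (m N : nat) (i : 'I_N) : odd (pe m i i) = false.
Proof. by rewrite odd_pe addbb. Qed.

Lemma odd_sum (I : Type) (s : seq I) (P : pred I) (F : I -> nat) :
  odd (\sum_(i <- s | P i) F i) = \big[addb/false]_(i <- s | P i) odd (F i).
Proof. exact: (big_morph odd oddD). Qed.

Lemma odd_sum_even (I : Type) (s : seq I) (P : pred I) (F : I -> nat) :
  (forall i, P i -> odd (F i) = false) -> odd (\sum_(i <- s | P i) F i) = false.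
Proof. by move=> h; rewrite odd_sum big1. Qed.

Section SuperImmanant.
Variables (m N : nat) (A : algType algC) (x : 'I_N -> 'I_N -> A).
Implicit Types (k : nat).

(* [term s I] is (-1)^I <I| s X_1 ... X_k |I>: the only intermediate index that
   contributes is J = I o s, and the signs of X_1 ... X_k cancel against those of
   the product by s. *)
Definition term_exp k (s : 'S_k) (I : idx N k) : nat :=
  (\sum_(a < k) par m (I a)
   + \sum_(a < k) \sum_(b < k | (a < b)%N)
       ((s b < s a)%N * (par m (I (s a)) * par m (I (s b)))
        + (par m (I b) + par m (I (s b))) * par m (I (s a))))%N.

Definition term k (s : 'S_k) (I : idx N k) : A :=
  (-1) ^+ term_exp s I * \prod_(a < k) x (I (s a)) (I a).

(** Stated for sorted sublists so that factors can be peeled off from the left. Positions outside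
    [l] carry the identity, and each head contributes its parity times the total parity of the
    tail. *)
Lemma Xprod_seqE k (l : seq 'I_k) (J L : idx N k) :
  sorted (fun a b : 'I_k => a < b)%N l ->
  (\big[@tmul m A N k/tone A]_(a <- l) Xa x a) J L =
  if [forall b, (b \notin l) ==> (J b == L b)] then
    (-1) ^+ (\sum_(a <- l) \sum_(b <- l | (a < b)%N)
               pe m (J a) (L a) * pe m (J b) (L b))%N
    * \prod_(a <- l) x (J a) (L a)
  else 0.
Proof.
have tr : transitive (fun a b : 'I_k => a < b)%N by move=> a b c; apply: ltn_trans.
elim: l J => [|c l IH] J sl.
  rewrite !big_nil mulr1 expr0 /tone.
  case: eqP => [->|ne]; first by case: ifP => // /forallP[] b; rewrite eqxx implybT.
  case: ifP => // /forallP h; case: ne; apply/ffunP => b.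
  by have := h b; rewrite in_nil => /eqP.
have /andP[lc sl'] : all (fun b : 'I_k => c < b)%N l && sorted (fun a b : 'I_k => a < b)%N l.
  by rewrite -(path_sortedE tr).
have cl : c \notin l by apply/negP => /(allP lc); rewrite ltnn.
rewrite big_cons /tmul.
(* [Xa x c] changes position [c] only and the tail leaves [c] alone, so a single intermediate index
   survives. *)
pose J' : idx N k := [ffun b => if b == c then L b else J b].
rewrite (bigD1 J') //= [X in _ + X]big1 ?addr0; last first.
  move=> K neK; rewrite IH // /Xa; case: ifP; rewrite ?mul0r ?mulr0 // => /forallP h1.
  case: ifP; rewrite ?mulr0 // => /forallP h2; case/eqP: neK; apply/ffunP=> b.
  rewrite ffunE; case: eqP => [->|/eqP nb]; first by have := h2 c; rewrite cl => /eqP.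
  by have := h1 b; rewrite nb => /eqP.
rewrite IH // /Xa.
have -> : [forall b, (b != c) ==> (J b == J' b)].
  by apply/forallP => b; apply/implyP => nb; rewrite ffunE (negPf nb).
have -> : [forall b, (b \notin l) ==> (J' b == L b)]
        = [forall b, (b \notin c :: l) ==> (J b == L b)].
  apply/eq_forallb => b; rewrite ffunE in_cons negb_or.
  by case: (b =P c) => [->|] //=; rewrite eqxx implybT.
case: ifP => [/forallP hJ|_]; last by rewrite !mulr0.
have J'c : J' c = L c by rewrite ffunE eqxx.
have J'n b : b != c -> J' b = J b by rewrite ffunE => /negPf ->.
rewrite J'c big_cons.
have -> : \prod_(j <- l) x (J' j) (L j) = \prod_(j <- l) x (J j) (L j).
  by apply: eq_big_seq => j jl; rewrite J'n //; apply: contraNneq cl => <-.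
have commS (e : nat) (y : A) : y * (-1) ^+ e = (-1) ^+ e * y by apply/commr_sign.
rewrite [x _ _ * (_ * _)]mulrA commS !mulrA -exprD -mulrA; congr (_ * _); last by rewrite big_cons.
apply: sign_congr; rewrite oddD /tsign !big_cons ltnn /=.
have -> : (\sum_(a <- l) \sum_(b <- c :: l | (a < b)%N) pe m (J a) (L a) * pe m (J b) (L b)
  = \sum_(a <- l) \sum_(b <- l | (a < b)%N) pe m (J' a) (L a) * pe m (J' b) (L b))%N.
  apply: eq_big_seq => a al; rewrite big_cons ltnNge (ltnW (allP lc _ al)) /=.
  rewrite big_seq_cond [RHS]big_seq_cond; apply: eq_bigr => b /andP[bl _].
  by rewrite !J'n //; apply: contraNneq cl => <-.
rewrite [RHS]oddD; congr (_ (+) _).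
(* An odd term would need [b = c]; then [a < c] lies outside the tail, where [J'] and [L] agree. *)
rewrite oddD oddM [odd (\sum_(a < k) \sum_(b < k | _) _)]odd_sum_even ?addbF; last first.
  move=> a _; apply: odd_sum_even => b lab; rewrite oddM.
  case: (b =P c) => [eb|/eqP/J'n->]; last by rewrite odd_pe_id.
  have nac : a != c by apply: contraTneq lab => ->; rewrite eb ltnn.
  have/implyP := hJ a; rewrite in_cons (negPf nac) /= (J'n a) // => h.
  rewrite (eqP (h _)) ?odd_pe_id ?andbF //.
  by apply/negP => /(allP lc); rewrite -eb ltnNge (ltnW lab).
have -> : odd (\sum_(a < k) pe m (J a) (J' a)) = odd (pe m (J c) (L c)).
  rewrite (bigD1 c) //= oddD J'c odd_sum_even ?addbF // => a /J'n ->.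
  exact: odd_pe_id.
have -> : (\sum_(j <- l | (c < j)%N) pe m (J c) (L c) * pe m (J j) (L j)
   = pe m (J c) (L c) * \sum_(j <- l) pe m (J j) (L j))%N.
  rewrite big_distrr /= [LHS]big_seq_cond [RHS]big_seq; apply: eq_bigl => j.
  by case jl: (j \in l); rewrite //= (allP lc _ jl).
rewrite oddM; congr (_ && _).
rewrite (bigID (mem l)) /= oddD [X in _ (+) X]odd_sum_even ?addbF; last first.
  move=> a al; case: (a =P c) => [->|/eqP nac]; first by rewrite J'c odd_pe_id.
  have/implyP := hJ a; rewrite in_cons negb_or nac al (J'n a) // => h.
  by rewrite (eqP (h _)) // odd_pe_id.
congr odd; rewrite -big_uniq /=; last first.
  by apply: (sorted_uniq tr) => // a; rewrite /= ltnn.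
by apply: eq_big_seq => j jl; rewrite J'n //; apply: contraNneq cl => <-.
Qed.

Lemma XprodE k (J L : idx N k) :
  Xprod m x J L =
    (-1) ^+ (\sum_(a < k) \sum_(b < k | (a < b)%N)
               pe m (J a) (L a) * pe m (J b) (L b))%N
    * \prod_(a < k) x (J a) (L a).
Proof.
rewrite /Xprod Xprod_seqE; last first.
  rewrite /index_enum -enumT.
  have := iota_ltn_sorted 0 k; rewrite -val_enum_ord sorted_map.
  exact.
by case: ifP => // /forallP[] b; rewrite mem_index_enum.
Qed.

Lemma superImmE k (chi : 'S_k -> algC) (I : idx N k) :
  superImm m x chi I = \sum_s chi s *: term s I.
Proof.
rewrite /superImm /bra_ket /tmul /chiT.
under [X in _ * (_ * X)]eq_bigr do rewrite mulr_suml mulr_sumr.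
rewrite exchange_big /= !mulr_sumr; apply: eq_bigr => s _.
pose J : idx N k := [ffun a => I (s a)].
rewrite (bigD1 J) //= [X in _ + X]big1 ?addr0 => [|K neK]; last first.
  rewrite /sigmaT; case: ifP => [/eqP eI|_]; last by rewrite scaler0 mul0r mulr0.
  by case/eqP: neK; apply/ffunP => a; rewrite ffunE eI ffunE permK.
rewrite /sigmaT ifT; last by apply/eqP/ffunP => a; rewrite !ffunE permKV.
rewrite -scalerAl !scaler_sign; congr (_ *: _).
rewrite XprodE !mulrA -!exprD /term; congr (_ * _); last first.
  by apply: eq_bigr => a _; rewrite ffunE.
apply: sign_congr; rewrite /gamma_sign /tsign /term_exp /inv_sign /act_sign.
rewrite !oddD !oddM -!addbA; congr (_ (+) _).
rewrite odd_sum_even => [|a _]; last by rewrite oddM oddD addbT andbN.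
rewrite [odd (\sum_(a < k) \sum_(b < k | _) _ * pe _ (I a) (I a))]odd_sum_even => [|a _]; last first.
  by apply: odd_sum_even => b _; rewrite oddM odd_pe_id andbF.
have sIJ : (\sum_(a < k) par m (J a) = \sum_(a < k) par m (I a))%N.
  by rewrite [RHS](reindex_perm s) /=; apply: eq_bigr => a _; rewrite ffunE.
(* [J] rearranges [I], so the total parities cancel: the operator of [s] is even. *)
have -> : odd (\sum_(a < k) pe m (I a) (J a)) = false.
  by rewrite big_split /= sIJ addnn odd_double.
under [in RHS]eq_bigr do rewrite big_split /=.
rewrite [in RHS]big_split /= [RHS]oddD.
set X := odd (\sum_(a < k) \sum_(b < k | _) pe m (I b) (J b) * pe m (J a) (I a))%N.
set Y := odd (\sum_(a < k) \sum_(b < k | _) pe m (J a) (I a) * pe m (J b) (I b))%N.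
have -> : Y = X.
  rewrite /X /Y; congr odd; apply: eq_bigr => a _; apply: eq_bigr => b _.
  by rewrite mulnC /pe (addnC (par m (J b))).
rewrite addbCA [X (+) (_ (+) X)]addbCA addbb addbF; congr (_ (+) _).
  congr odd; apply: eq_bigr => a _; rewrite big_mkcondr /=.
  by apply: eq_bigr => b _; rewrite !ffunE; case: ifP; rewrite ?mul1n ?mul0n.
by congr odd; apply: eq_bigr => a _; apply: eq_bigr => b _; rewrite /pe !ffunE.
Qed.
End SuperImmanant.

(** * Invariance under simultaneous permutation *)

(* An adjacent transposition reverses the order of no pair except (c, c'). *)
Lemma sum_ltn_pair_swap k (c c' : 'I_k) (f : 'I_k -> 'I_k -> nat) :
  c' = c.+1 :> nat -> let t := tperm c c' in
  (\sum_(a < k) \sum_(b < k | (a < b)%N) f (t a) (t b) + f c c'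
   = \sum_(a < k) \sum_(b < k | (a < b)%N) f a b + f c' c)%N.
Proof.
move=> cc' t; have lcc : (c < c')%N by rewrite cc'.
rewrite !pair_big_dep /= (bigD1 (c, c')) //= [in RHS](bigD1 (c, c')) //=.
rewrite {1 2}/t tpermL tpermR.
suff -> : (\sum_(p : 'I_k * 'I_k | (p.1 < p.2)%N && (p != (c, c'))) f (t p.1) (t p.2)
         = \sum_(p : 'I_k * 'I_k | (p.1 < p.2)%N && (p != (c, c'))) f p.1 p.2)%N.
  by rewrite addnC addnA addnAC.
pose t2 (p : 'I_k * 'I_k) := (t p.1, t p.2).
have t2K : involutive t2 by case=> a b; rewrite /t2 /= !tpermK.
rewrite [RHS](reindex_inj (inv_inj t2K)) /=; apply: eq_bigl => -[a b] /=.
have tv (d : 'I_k) : t d = (if d == c :> nat then c.+1 else if d == c.+1 :> nat then c : nat else d) :> nat.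
  rewrite /t -cc'; case: tpermP => [->|->|/eqP/negPf+ /eqP/negPf+]; rewrite ?eqxx //.
    by case: eqP.
  by rewrite -!val_eqE /= => -> ->.
rewrite /t2 /= !xpair_eqE -!val_eqE /= !tv cc'.
case: (nat_of_ord a == c) / eqP => ?; case: (nat_of_ord a == c.+1) / eqP => ?;
case: (nat_of_ord b == c) / eqP => ?; case: (nat_of_ord b == c.+1) / eqP => ?; lia.
Qed.

(** The product is cut around the adjacent positions [c] and [c']; [e] comes out of the swapped pair
    and crosses the prefix because it is central. *)
Lemma prod_swap (A : pzRingType) k (c c' : 'I_k) (y : 'I_k -> A) (e : A) :
  c' = c.+1 :> nat -> y c' * y c = e * (y c * y c') ->
  (forall z, GRing.comm e z) ->
  \prod_(a < k) y (tperm c c' a) = e * \prod_(a < k) y a.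
Proof.
case: k c c' y => [[]//|k] c c' y cc' yy ce.
have conv (z : 'I_k.+1 -> A) : \prod_(a < k.+1) z a = \prod_(0 <= a < k.+1) z (inord a).
  by rewrite big_mkord; apply: eq_bigr => a _; rewrite inord_val.
have c'k : (c.+1 < k.+1)%N by rewrite -cc'.
have ck : (c <= k.+1)%N by apply: ltnW.
rewrite !conv !(big_cat_nat (leq0n c) ck) /= !(big_ltn (ltn_ord c)) !(big_ltn c'k).
have -> : inord c = c :> 'I_k.+1 by apply: inord_val.
have -> : inord c.+1 = c' :> 'I_k.+1 by rewrite -cc'; apply: inord_val.
rewrite tpermL tpermR.
have h lo hi : (forall i, lo <= i < hi -> (i != c) && (i != c.+1))%N -> (hi <= k.+1)%N ->
  \prod_(lo <= a < hi) y (tperm c c' (inord a)) = \prod_(lo <= a < hi) y (inord a).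
  move=> hi1 hi2; apply: eq_big_nat => i /[dup] /hi1 /andP[ic ic'] /andP[_ il].
  have e1 : nat_of_ord (inord i : 'I_k.+1) = i by rewrite inordK // (leq_trans il).
  by rewrite tpermD // -val_eqE /= ?cc' e1 eq_sym.
rewrite !h => [|i /andP[h1 h2]||i /andP[h1 h2]|] //.
- set P := \prod_(0 <= a < c) _; set Q := \prod_(_ <= a < _) _.
  by rewrite [y c' * _]mulrA yy -!mulrA mulrA -(ce P) -!mulrA.
- by rewrite !gtn_eqF // (ltnW h1).
- by rewrite !ltn_eqF // (ltn_trans h2).
Qed.

(** The map [(a, b) |-> (s b, s a)] matches the inversions of [s] with those of its inverse. This
    trades a relabelling of values for one of positions. *)
Lemma inversion_sum_inv k (s : 'S_k) (h : 'I_k -> nat) :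
  (\sum_(a < k) \sum_(b < k | (a < b)%N) (s b < s a)%N * (h (s a) * h (s b))
   = \sum_(a < k) \sum_(b < k | (a < b)%N) ((s^-1)%g b < (s^-1)%g a)%N * (h a * h b))%N.
Proof.
rewrite !pair_big_dep /=.
pose f (p : 'I_k * 'I_k) := ((s^-1)%g p.2, (s^-1)%g p.1).
pose f' (p : 'I_k * 'I_k) := (s p.2, s p.1).
have fK : cancel f f' by case=> a b; rewrite /f /f' /= !permKV.
have f'K : cancel f' f by case=> a b; rewrite /f /f' /= !permK.
rewrite big_mkcond [RHS]big_mkcond /= (reindex f) /=; last first.
  by exists f' => p _; rewrite ?fK ?f'K.
apply: eq_bigr => -[a b] _ /=; rewrite !permKV [(h b * _)%N]mulnC.
by case: (a < b)%N; case: (_ < _)%N.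
Qed.

Section Conj.
Variables (m N : nat) (A : algType algC) (x : 'I_N -> 'I_N -> A).
Hypothesis hx : forall i j k l : 'I_N,
  x i j * x k l = (-1) ^+ (pe m i j * pe m k l)%N * (x k l * x i j).

(** The inverse gives [ipre I t (t a) = I a], matching the way [s ^ t] sends [t a] to [t (s a)]. *)
Definition ipre k (I : idx N k) (t : 'S_k) : idx N k := [ffun a => I ((t^-1)%g a)].

(* The sign picked up is exactly that of exchanging the two adjacent factors
   x (I (s c)) (I c) and x (I (s c')) (I c'). *)
Lemma term_exp_conj k (s : 'S_k) (I : idx N k) (c c' : 'I_k) :
  c' = c.+1 :> nat ->
  odd (term_exp m (s ^ tperm c c')%g (ipre I (tperm c c')))
  = odd (term_exp m s I + pe m (I (s c)) (I c) * pe m (I (s c')) (I c')).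
Proof.
move=> cc'; set t := tperm c c'; have tK := tpermK c c' : involutive t.
have It a : ipre I t (t a) = I a by rewrite ffunE permK.
pose f a b := ((t (s b) < t (s a))%N * (par m (I (s a)) * par m (I (s b)))
        + (par m (I b) + par m (I (s b))) * par m (I (s a)))%N.
pose g a b := (((s^-1)%g b < (s^-1)%g a)%N * (par m (I a) * par m (I b)))%N.
have e1 := sum_ltn_pair_swap f cc'; have e2 := sum_ltn_pair_swap g cc'.
rewrite -/t in e1 e2.
have E1 : term_exp m (s ^ t)%g (ipre I t) =
  (\sum_(a < k) par m (I a) + \sum_(a < k) \sum_(b < k | (a < b)%N) f (t a) (t b))%N.
  rewrite /term_exp; congr addn.
    by rewrite [LHS](reindex_perm t) /=; apply: eq_bigr => a _; rewrite It.
  apply: eq_bigr => a _; apply: eq_bigr => b _.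
  by rewrite -{1 2 3}[a]tK -{1 2 3 4}[b]tK !permJ !It.
pose d := (\sum_(a < k) \sum_(b < k | (a < b)%N)
            (par m (I b) + par m (I (s b))) * par m (I (s a)))%N.
(* Passing to inverses turns the relabelled values [t (s a)] into relabelled positions, so that the
   adjacent swap identity [e2] applies. *)
have E2 : (\sum_(a < k) \sum_(b < k | (a < b)%N) f a b =
   \sum_(a < k) \sum_(b < k | (a < b)%N) g (t a) (t b) + d)%N.
  rewrite /f /d; under eq_bigr do rewrite big_split /=.
  rewrite big_split /=; congr addn.
  transitivity (\sum_(a < k) \sum_(b < k | (a < b)%N) ((s * t)%g b < (s * t)%g a)%N *
      (par m (I (t ((s * t)%g a))) * par m (I (t ((s * t)%g b)))))%N.
    by apply: eq_bigr => a _; apply: eq_bigr => b _; rewrite !permM !tK.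
  rewrite (inversion_sum_inv (s * t) (fun a => par m (I (t a)))).
  apply: eq_bigr => a _; apply: eq_bigr => b _.
  by rewrite invMg tpermV !permM.
have E3 : term_exp m s I = (\sum_(a < k) par m (I a) +
   (\sum_(a < k) \sum_(b < k | (a < b)%N) g a b + d))%N.
  rewrite /term_exp /d; congr addn; under eq_bigr do rewrite big_split /=.
  rewrite big_split /=; congr addn.
  exact: (inversion_sum_inv s (fun a => par m (I a))).
have sc : c != c' by rewrite -val_eqE /= cc' neq_ltn ltnSn.
have gg : (g c c' + g c' c = par m (I c) * par m (I c'))%N.
  have : (s^-1)%g c != (s^-1)%g c' by rewrite (inj_eq perm_inj).
  by rewrite -val_eqE /= /g; nia.
have ff : odd (f c c' + f c' c + par m (I c) * par m (I c')) =
    odd (pe m (I (s c)) (I c) * pe m (I (s c')) (I c')).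
  have : t (s c) != t (s c') by rewrite !(inj_eq perm_inj).
  rewrite -val_eqE /= /f => ne.
  have -> : (t (s c) < t (s c'))%N = ~~ (t (s c') < t (s c))%N.
    by move: ne; case: ltngtP.
  rewrite /pe !(oddD, oddM) /par !oddb.
  case: (m <= I (s c))%N; case: (m <= I (s c'))%N; case: (m <= I c)%N; case: (m <= I c')%N;
    by case: (t (s c') < t (s c))%N.
move: (congr1 odd e1) (congr1 odd e2) (congr1 odd gg).
rewrite E1 E2 E3 !oddD -ff !oddD => h1 h2 h3.
move: h1 h2 h3; do !move: (odd _).
by do !case.
Qed.

Lemma term_conj_adjacent k (s : 'S_k) (I : idx N k) (c c' : 'I_k) :
  c' = c.+1 :> nat ->
  term m x (s ^ tperm c c')%g (ipre I (tperm c c')) = term m x s I.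
Proof.
move=> cc'; rewrite /term; set t := tperm c c'.
pose y a := x (I (s a)) (I a).
have -> : \prod_(a < k) x (ipre I t ((s ^ t)%g a)) (ipre I t a) = \prod_(a < k) y (t a).
  by apply: eq_bigr => a _; rewrite -{1 2}[a](tpermK c c') permJ !ffunE !permK.
rewrite (prod_swap (e := (-1) ^+ (pe m (I (s c)) (I c) * pe m (I (s c')) (I c'))%N) cc').
- rewrite mulrA -exprD; congr (_ * _); apply: sign_congr.
  by rewrite oddD term_exp_conj // oddD -addbA addbb addbF.
- by rewrite mulnC; exact: hx.
- by move=> z; apply/commr_sym/commr_sign.
Qed.

(** The admissible [t] are closed under products. Conjugating by an adjacent transposition lengthens
    a transposition by one step, so all transpositions, and hence all permutations, are reached. *)
Lemma term_conj k (t s : 'S_k) (I : idx N k) :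
  term m x (s ^ t)%g (ipre I t) = term m x s I.
Proof.
pose P (t : 'S_k) := forall s I, term m x (s ^ t)%g (ipre I t) = term m x s I.
rewrite -/(P t).
have PM u v : P u -> P v -> P (u * v)%g.
  move=> Pu Pv s' I'; rewrite conjgM -(Pu s' I') -(Pv _ (ipre I' u)); congr term.
  by apply/ffunP => a; rewrite !ffunE invMg permM.
have P1 : P 1%g.
  by move=> s' I'; rewrite conjg1; congr term; apply/ffunP => a; rewrite ffunE invg1 perm1.
have Plt d (i j : 'I_k) : j = (i + d).+1 :> nat -> P (tperm i j).
  elim: d j => [|d IHd] j; first by rewrite addn0 => ij s' I'; apply: term_conj_adjacent.
  move=> ij; have lj : ((i + d).+1 < k)%N by have := ltn_ord j; lia.
  pose j' := Ordinal lj.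
  have Pj : P (tperm j' j) by move=> s' I'; apply: term_conj_adjacent; rewrite ij addnS.
  have -> : tperm i j = (tperm i j' ^ tperm j' j)%g.
    rewrite tpermJ tpermL tpermD // -val_eqE /=; first by rewrite gtn_eqF // ltnS leq_addr.
    by rewrite ij gtn_eqF // ltnS leq_addr.
  rewrite conjgE tpermV; apply: (PM _ _ Pj); apply: (PM _ _ _ Pj); exact: IHd.
have Ptp (i j : 'I_k) : P (tperm i j).
  case: (ltngtP i j) => [ij|ij|/val_inj->].
  - by apply: (Plt (j - i).-1); lia.
  - by rewrite tpermC; apply: (Plt (i - j).-1); lia.
  - by rewrite tperm1.
have [ts -> _] := prod_tpermP t.
by apply: (big_ind P) => // p _; apply: Ptp.
Qed.
End Conj.

(** * Sorted multi-indices *)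

(** The stabilizer of [K] is the product of the symmetric groups on its fibres, which are split off
    one value at a time. *)
Lemma card_fibre_perms (T V : finType) (K : T -> V) :
  #|[set s : {perm T} | [forall a, K (s a) == K a]]|
  = (\prod_v #|[set a | K a == v]|`!)%N.
Proof.
(* [G l] also fixes all points whose value is outside [l]: trivial for the empty list, the full
   stabilizer for the list of all values. *)
pose G (l : seq V) := [set s : {perm T} | [forall a, (K (s a) == K a) && ((K a \in l) || (s a == a))]].
have GP (l : seq V) (s : {perm T}) : reflect (forall a, K (s a) = K a /\ (K a \notin l -> s a = a)) (s \in G l).
  rewrite inE; apply: (iffP forallP) => h a; have := h a.
    by case/andP=> /eqP ? /orP[->//|/eqP ?].
  by case=> -> h2; rewrite eqxx; case: (boolP (K a \in l)) => //= /h2 ->; rewrite eqxx.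
suff h l : uniq l -> #|G l| = (\prod_(v <- l) #|[set a | K a == v]|`!)%N.
  rewrite -big_enum -h ?enum_uniq //=.
  apply: eq_card => s; rewrite !inE; apply: eq_forallb => a.
  by rewrite mem_enum orTb andbT.
elim: l => [_|v l IH /= /andP[vl ul]].
  rewrite big_nil -(cards1 (1%g : {perm T})); apply: eq_card => s.
  rewrite in_set1; apply/GP/eqP => [h|->].
    by apply/permP => a; rewrite perm1; apply: (h a).2.
  by move=> a; rewrite perm1.
set S := [set a | K a == v].
have cS : (#|S|`! = #|[set p : {perm T} | perm_on S p]|)%N by rewrite -card_perm cardsE.
rewrite big_cons -IH // -/S cS -cardsX.
pose f (p : {perm T} * {perm T}) := (p.1 * p.2)%g.
have GS q a : q \in G l -> a \in S -> q a = a.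
  by move/GP=> h; rewrite inE => /eqP e; apply: (h a).2; rewrite e.
have fS p q a : perm_on S p -> q \in G l -> f (p, q) a = if a \in S then p a else q a.
  move=> pS qG; rewrite /f permM /=; case: ifP => aS.
    by rewrite (GS _ _ qG) // perm_closed.
  by rewrite (out_perm pS) ?aS.
rewrite -(card_in_imset (f := f)); last first.
  move=> [p q] [p' q'] /setXP[/= + qG] /setXP[/= + qG']; rewrite !inE => pS pS' e.
  have ea a : (if a \in S then p a else q a) = (if a \in S then p' a else q' a).
    by rewrite -!fS // e.
  congr (_, _); apply/permP => a; have := ea a; case: ifP => // aS _.
    by rewrite !(out_perm _ (negbT aS)).
  by rewrite (GS q) ?(GS q').
apply: eq_card => s; apply/GP/imsetP => [h|[[p q] /setXP[/=]]]; last first.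
  rewrite inE => pS qG -> a; rewrite fS //; have := GP _ _ qG a.
  case: ifP => [aS _|aS [-> h]].
    have := perm_closed a pS; rewrite aS !inE => /eqP ->; move: aS; rewrite inE => /eqP ->.
    by split=> //; rewrite eqxx.
  split=> // h'; apply: h; move: h'; rewrite inE negb_or => /andP[] //.
have sS a : (s a \in S) = (a \in S) by rewrite !inE (h a).1.
(* The restriction of [s] to the fibre of [v] is the first factor; dividing by it leaves an element
   of [G l]. *)
pose p0 a := if a \in S then s a else a.
have p0_inj : injective p0.
  move=> a b; rewrite /p0; case: ifP; case: ifP => aS bS //.
  - exact: perm_inj.
  - by move=> e; rewrite -sS e aS in bS.
  - by move=> e; rewrite -sS -e bS in aS.
have pS : perm_on S (perm p0_inj).
  by apply/subsetP => a; rewrite inE permE /p0; case: ifP => //; rewrite eqxx.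
exists (perm p0_inj, (perm p0_inj)^-1 * s)%g; last by rewrite /f /= mulKVg.
apply/setXP; split=> /=; first by rewrite inE.
apply/GP => a; rewrite permM.
set b := ((perm p0_inj)^-1)%g a; have -> : a = perm p0_inj b by rewrite permKV.
rewrite permE /p0; case: ifP => bS; first by [].
have [h1 h2] := h b; split => // bl; apply: h2; rewrite inE negb_or bl andbT.
by move: bS; rewrite inE => /negbT.
Qed.

Lemma nondecr_homo N k (I : idx N k) :
  reflect (forall a b : 'I_k, (a <= b)%N -> (I a <= I b)%N) (nondecr I).
Proof.
apply: (iffP forallP) => [h a b ab|h a]; last first.
  by apply/forallP => b; apply/implyP; apply: h.
by have /forallP/(_ b)/implyP := h a; apply.
Qed.

Lemma nondecr_codom N k (I : idx N k) :
  nondecr I = sorted (fun i j : 'I_N => i <= j)%N [seq I a | a <- enum 'I_k].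
Proof.
apply/nondecr_homo/idP => [h|h a b ab].
  apply: (homo_sorted (e := fun a b : 'I_k => a <= b)%N); first exact: h.
  have := iota_sorted 0 k; rewrite -val_enum_ord sorted_map.
  exact.
have tr : transitive (fun i j : 'I_N => i <= j)%N by move=> ? ? ?; apply: leq_trans.
have := sorted_leq_nth tr (fun i => leqnn i) (I a) h a b.
rewrite !inE size_map size_enum_ord !ltn_ord => /(_ isT isT ab).
by rewrite !(nth_map a) -?enumT ?size_enum_ord // !nth_ord_enum.
Qed.

Lemma nondecr_ipre_uniq N k (K : idx N k) (s s' : 'S_k) :
  nondecr (ipre K s) -> nondecr (ipre K s') -> ipre K s = ipre K s'.
Proof.
rewrite !nondecr_codom => h h'.
have pe_K (t : 'S_k) : perm_eq [seq ipre K t a | a <- enum 'I_k] [seq K a | a <- enum 'I_k].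
  have -> : [seq ipre K t a | a <- enum 'I_k]
          = [seq K a | a <- [seq (t^-1)%g a | a <- enum 'I_k]].
    by rewrite -[RHS]map_comp; apply: eq_map => a; rewrite ffunE.
  apply: perm_map; apply: uniq_perm; rewrite ?enum_uniq //.
    by rewrite (map_inj_uniq perm_inj) enum_uniq.

  move=> a; rewrite mem_enum; apply/mapP; exists (t a); rewrite ?mem_enum //.
  by rewrite permK.
have eqK : [seq ipre K s a | a <- enum 'I_k] = [seq ipre K s' a | a <- enum 'I_k].
  apply: (sorted_eq (leT := fun i j : 'I_N => i <= j)%N) => //.
  - by move=> ? ? ?; apply: leq_trans.
  - by move=> i j /anti_leq/val_inj.
  - by rewrite (perm_trans (pe_K s)) // perm_sym.
by apply/ffunP => a; move/eq_in_map: eqK => /(_ a); apply; rewrite mem_enum.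
Qed.

Lemma nondecr_ipre_ex N k (K : idx N k) : exists s, nondecr (ipre K s).
Proof.
pose t := [tuple K a | a < k]; pose leI (i j : 'I_N) := (i <= j)%N.
have sz : size (sort leI t) == k by rewrite size_sort size_tuple.
have /tuple_permP[p ep] : perm_eq (Tuple sz) t by rewrite perm_sort.
exists (p^-1)%g; rewrite nondecr_codom.
suff -> : [seq ipre K p^-1 a | a <- enum 'I_k] = sort leI t.
  by apply: sort_sorted => i j; apply: leq_total.
rewrite -[sort leI t]/(val (Tuple sz)) /= ep /=; apply: eq_map => a.
by rewrite ffunE invgK tnth_mktuple.
Qed.

(** The sorting permutations form a coset of the stabilizer of [K]. *)
Lemma card_nondecr_ipre N k (K : idx N k) :
  #|[set s | nondecr (ipre K s)]| = alpha K.
Proof.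
have [s0 h0] := nondecr_ipre_ex K.
rewrite /alpha -(card_fibre_perms K) -[RHS](card_imset _ (mulIg s0)).
apply/esym/eq_card => s; rewrite [RHS]in_set; apply/imsetP/idP => [[u]|hs].
  rewrite inE => /forallP hu ->.
  suff -> : ipre K (u * s0)%g = ipre K s0 by [].
  apply/ffunP => a; rewrite !ffunE invMg permM -{2}[(s0^-1)%g a](permKV u).
  by rewrite (eqP (hu _)).
exists (s * s0^-1)%g; last by rewrite mulgKV.
rewrite inE; apply/forallP => a; apply/eqP.
have /ffunP/(_ (s a)) := nondecr_ipre_uniq hs h0.
by rewrite !ffunE permK permM => ->.
Qed.

Lemma alpha_gt0 N k (I : idx N k) : (0 < alpha I)%N.
Proof. by rewrite /alpha prodn_gt0 // => i; apply: fact_gt0. Qed.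

Lemma alpha_ipre N k (I : idx N k) (t : 'S_k) : alpha (ipre I t) = alpha I.
Proof.
apply: eq_bigr => i _; congr _`!.
rewrite -[RHS](card_imset _ (@perm_inj _ t)); apply: eq_card => a; rewrite inE ffunE.
apply/idP/imsetP => [h|[b]]; last by rewrite inE => h ->; rewrite permK.
by exists ((t^-1)%g a); rewrite ?inE // permKV.
Qed.

Lemma ipre_inj N k (t : 'S_k) : injective (fun I : idx N k => ipre I t).
Proof.
by move=> I J /ffunP e; apply/ffunP => a; have := e (t a); rewrite !ffunE permK.
Qed.

(** Double counting of the pairs [(s, I)] with [ipre I s] sorted: each [s] contributes the left-hand
    sum, and each [I] occurs [alpha I] times. *)
Lemma sum_nondecr N k (V : lmodType algC) (g : idx N k -> V) :
  (forall I t, g (ipre I t) = g I) ->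
  \sum_(I | nondecr I) ((alpha I)%:R : algC)^-1 *: g I
  = ((k`!)%:R : algC)^-1 *: \sum_I g I.
Proof.
move=> gE; have nz d : (0 < d)%N -> (d%:R : algC) != 0.
  by rewrite lt0n Num.Theory.pnatr_eq0.
apply: (canRL (scalerK (nz _ (fact_gt0 k)))).
have -> : k`! = #|{: 'S_k}| by rewrite card_Sn.
rewrite scaler_nat -sumr_const.
transitivity (\sum_(s : 'S_k) \sum_(I | nondecr (ipre I s)) ((alpha I)%:R : algC)^-1 *: g I).
  apply: eq_bigr => s _; rewrite (reindex_inj (@ipre_inj N k s)) /=.
  by apply: eq_bigr => I _; rewrite alpha_ipre gE.
rewrite (exchange_big_dep xpredT) //=; apply: eq_bigr => I _.
rewrite sumr_const -scaler_nat scalerA -[#|_|]cardsE card_nondecr_ipre.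
by rewrite mulfV ?scale1r // nz // alpha_gt0.
Qed.

(** * Reduction to Hessenberg permutations *)

(* Only the conditions on columns >= k are imposed, and only the superdiagonal
   entries in those columns are counted; k = 0 gives the Hessenberg condition and
   its full weight, k = r imposes nothing. *)
Definition hess_from r (k : nat) (s : 'S_r) :=
  [forall i : 'I_r, (k <= s i)%N ==> (s i <= i.+1)%N].

Definition hess_weight r (k : nat) (s : 'S_r) :=
  (\prod_(i < r | (k <= s i)%N && (s i == i.+1 :> nat)) i.+1)%N.

Section HessenbergReduction.
Variables (r : nat) (V : nmodType) (F : 'S_r -> V).
Hypothesis FJ : forall s t, F (s ^ t)%g = F s.

(** Under the condition, an entry in a column beyond [k] lies in a row at least [k], so conjugation
    fixes both its row and its column. *)
Lemma hess_from_conj k (s t : 'S_r) :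
  (forall i : 'I_r, (k <= i)%N -> t i = i) ->
  hess_from k.+1 (s ^ t)%g = hess_from k.+1 s.
Proof.
have main (u v : 'S_r) : (forall i : 'I_r, (k <= i)%N -> v i = i) ->
    hess_from k.+1 u -> hess_from k.+1 (u ^ v)%g.
  move=> vk /forallP hu; apply/forallP => j.
  rewrite -[j](permKV v); move: ((v^-1)%g j) => i {j}; rewrite permJ.
  apply/implyP => h.
  have e : v (u i) = u i by apply: (@perm_inj _ v); rewrite vk // ltnW.
  have ui : (u i <= i.+1)%N by have /implyP := hu i; apply; rewrite -e.
  by rewrite e vk // -ltnS (leq_trans _ ui) // -e.
move=> tk; apply/idP/idP; last exact: main.
have tVk (i : 'I_r) : (k <= i)%N -> (t^-1)%g i = i.
  by move=> /tk e; apply: (@perm_inj _ t); rewrite permKV e.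
by move=> h; rewrite -[s](conjgK t); apply: main.
Qed.

Lemma hess_weight_conj k (s t : 'S_r) :
  (forall i : 'I_r, (k <= i)%N -> t i = i) ->
  hess_weight k.+1 (s ^ t)%g = hess_weight k.+1 s.
Proof.
move=> tk; rewrite /hess_weight [LHS](reindex_perm t) /=.
have tE (i : 'I_r) : (k <= t i)%N -> t i = i.
  by move=> /tk; apply: perm_inj.
apply: eq_big => [i|i /andP[h1 /eqP h2]]; last first.
  by rewrite tE // -ltnS -h2.
rewrite permJ; apply/idP/idP => /andP[h1 /eqP h2].
  have e1 := tE _ (ltnW h1); have e2 : t i = i by apply: tE; rewrite -ltnS -h2.
  by move: h1 h2; rewrite e1 e2 => -> ->; rewrite eqxx.
have hk : (k <= s i)%N by apply: ltnW.
have hi : (k <= i)%N by rewrite -ltnS -h2.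
by rewrite (tk _ hk) (tk _ hi) h1 h2 eqxx.
Qed.

Lemma hess_step k : (k < r)%N ->
  \sum_(s | hess_from k.+1 s) F s *+ hess_weight k.+1 s
  = \sum_(s | hess_from k s) F s *+ hess_weight k s.
Proof.
move=> kr; pose K := Ordinal kr.
have VK (s : 'S_r) i : ((s^-1)%g K == i) = (s i == K).
  by apply/eqP/eqP => [<-|<-]; rewrite ?permKV ?permK.
rewrite (bigID (fun s : 'S_r => k <= (s^-1)%g K)%N) [RHS](bigID (fun s : 'S_r => k <= (s^-1)%g K)%N) /=.
have hk (s : 'S_r) i : (k <= s i)%N = (k < s i)%N || ((s^-1)%g K == i).
  by rewrite VK leq_eqVlt orbC -val_eqE /= eq_sym.
congr (_ + _).
  (* If the entry of column [k] is on or below the diagonal, the extra condition holds and the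
     weight gains nothing. *)
  apply: eq_big => [s|s /andP[_ h]].
    apply/andP/andP => -[/forallP h1 h2]; split=> //; apply/forallP => i; apply/implyP.
      rewrite hk => /orP[|/eqP <-]; first exact/implyP.
      by rewrite permKV /= ltnW.
    by move=> ki; have /implyP := h1 i; apply; apply: ltnW.
  congr (_ *+ _); apply: eq_bigl => i; rewrite hk.
  case: ltnP => //= _; case: eqP => //= e; move: h; rewrite e => h.
  have -> : s i = K by apply/eqP; rewrite -VK e.
  by rewrite /= ltn_eqF.
(* Otherwise the entry is above the diagonal, which cannot happen in column 0; from here on the
   column is [k.+1]. *)
case: k kr @K VK hk => [|k] kr K VK hk; first by rewrite !big1 // => s; rewrite leq0n andbF.
have kr' : (k < r)%N by apply: ltnW.
pose K' := Ordinal kr'.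
pose G (c : 'I_r) := \sum_(s | hess_from k.+2 s && ((s^-1)%g K == c)) F s *+ hess_weight k.+2 s.
(* Conjugation by [tperm c K'] moves the entry of column [K] from row [c] to row [K'] and fixes
   every index beyond [k]. *)
have GE (c : 'I_r) : (c < k.+1)%N -> G c = G K'.
  move=> ck; pose t := tperm c K'.
  have tk (i : 'I_r) : (k < i)%N -> t i = i.
    by move=> ki; rewrite /t tpermD // -val_eqE /= ltn_eqF // (leq_trans ck).
  rewrite /G [RHS](reindex_inj (conjg_inj t)) /=; apply: eq_big => s.
    rewrite hess_from_conj //; congr (_ && _).
    have e1 : (s ^ t)%g K' = t (s c) by rewrite -permJ tpermL.
    by rewrite !VK e1 -{2}(tk K) // (inj_eq perm_inj).
  by move=> _; rewrite FJ hess_weight_conj.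
transitivity (\sum_(c < r | (c < k.+1)%N) G c).
  rewrite (partition_big (fun s : 'S_r => (s^-1)%g K) (fun c => c < k.+1)%N) /=; last first.
    by move=> s /andP[_]; rewrite -ltnNge.
  apply: eq_bigr => c ck; apply: eq_bigl => s.
  rewrite -ltnNge; case: eqP => [->|]; rewrite ?andbF // ck !andbT //.
(* The [k.+1] rows above the diagonal contribute equally; the Hessenberg condition in column [K]
   keeps only row [K'], whose superdiagonal weight is [k.+1]. *)
transitivity (G K' *+ k.+1).
  rewrite (eq_bigr (fun=> G K')) => [|c /GE//].
  by rewrite (big_ord_narrow (ltnW kr)) sumr_const card_ord.
rewrite -sumrMnl; apply: eq_big => [s|s /andP[_ /eqP e]].
  rewrite -ltnNge; apply/andP/andP => -[/forallP h1 h2]; split.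
  - apply/forallP => i; apply/implyP; rewrite hk => /orP[|/eqP <-]; first exact/implyP.
    by rewrite permKV (eqP h2).
  - by rewrite (eqP h2).
  - apply/forallP => i; apply/implyP => ki; have /implyP := h1 i; apply; exact: ltnW.
  - have /implyP := h1 ((s^-1)%g K); rewrite permKV => /(_ (leqnn _)) h3.
    by rewrite -val_eqE eqn_leq /= -ltnS h2 -ltnS.
rewrite -mulrnA; congr (_ *+ _).
have sK' : s K' = K by apply/eqP; rewrite -VK e.
rewrite [RHS](bigD1 K') ?sK' ?leqnn ?eqxx //= mulnC; congr (_ * _)%N.
apply: eq_bigl => i; rewrite hk e [K' == i]eq_sym.
by case: (i =P K') => [->|]; rewrite ?sK' ?ltnn ?andbF ?orbF ?andbT.
Qed.

Lemma sum_hess : \sum_s F s = \sum_(s | hess_from 0 s) F s *+ hess_weight 0 s.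
Proof.
have h k : (k <= r)%N -> \sum_(s | hess_from (r - k) s) F s *+ hess_weight (r - k) s = \sum_s F s.
  elim: k => [_|k IH kr].
    rewrite subn0; apply: eq_big => s; last first.
      move=> _; rewrite /hess_weight big1 // => i; by rewrite leqNgt ltn_ord.
    by apply/forallP => i; rewrite leqNgt ltn_ord.
  rewrite -[RHS]IH ?(ltnW kr) // -(subnSK kr); apply/esym/hess_step.
  by rewrite -subSn // subSS leq_subr.
by rewrite -(h r) // subnn.
Qed.
End HessenbergReduction.

(** * Hessenberg permutations and powers of the supermatrix *)

(* A Hessenberg permutation is read as a function on nat that either moves k to
   k+1 or closes the current interval, whose first element is [block_start s k]. *)
Fixpoint block_start (s : nat -> nat) (k : nat) : nat :=
  if k is k'.+1 then if s k' == k then block_start s k' else k else 0.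

Lemma block_start_le s k : (block_start s k <= k)%N.
Proof. by elim: k => //= k IH; case: ifP => // _; apply: leqW. Qed.

Definition block_fun (s : nat -> nat) (r : nat) :=
  forall k, (k < r)%N -> s k = k.+1 \/ s k = block_start s k.

Lemma block_fun_closing s k : s k = block_start s k -> (s k == k.+1) = false.
Proof. by move=> ->; rewrite ltn_eqF // ltnS block_start_le. Qed.

Lemma block_fun_le s r k : block_fun s r -> (k < r)%N -> (s k <= k.+1)%N.
Proof.
by move=> hs /hs[] ->; rewrite // leqW // block_start_le.
Qed.

(* The values of s on [0, r) are [0, r] without the start of the open interval. *)
Lemma sum_block_fun s r (f : nat -> nat) : block_fun s r ->
  (\sum_(0 <= a < r) f (s a) + f (block_start s r) = \sum_(0 <= u < r.+1) f u)%N.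
Proof.
elim: r => [|r IH] hs; first by rewrite big_nil big_nat1.
have {}IH := IH (fun k kr => hs k (ltnW kr)).
rewrite big_nat_recr //= [RHS]big_nat_recr //= -IH.
have [e|e] := hs r (ltnSn r); first by rewrite e eqxx addnAC -addnA addnC.
by rewrite block_fun_closing // e.
Qed.

(** The double sum of [term_exp] over naturals, with the larger position outermost so that a step in
    [k] adds one inner sum; [i] stands for the parities. *)
Definition block_exp (s i : nat -> nat) (k : nat) : nat :=
  (\sum_(0 <= b < k) \sum_(0 <= a < b)
    ((s b < s a)%N * (i (s a) * i (s b)) + (i b + i (s b)) * i (s a)))%N.

(* The terms after the first sum account for the interval still open at r; they
   cancel when [block_start s r = r]. *)
Lemma odd_block_exp s r (i : nat -> nat) : block_fun s r ->
  let c := block_start s r in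
  let q k := (\sum_(0 <= u < k) i u)%N in
  odd (q r + block_exp s i r)
  = odd (\sum_(0 <= a < r | s a != a.+1) i (s a)
         + i c + i c * i r + i c * q c + i r * q r)%N.
Proof.
move=> hs c q; rewrite {}/c; elim: r hs => [|r IH] hs.
  by rewrite /q /block_exp !big_nil /= !muln0 !addn0 !add0n oddD oddM andbb addbb.
have hs' : block_fun s r by move=> k kr; apply: hs; apply: ltnW.
have {}IH := IH hs'.
have qS k : q k.+1 = (q k + i k)%N by rewrite /q big_nat_recr.
pose c := block_start s r; pose S := (\sum_(0 <= a < r) i (s a))%N.
pose R := (\sum_(0 <= a < r) (s r < s a)%N * i (s a))%N.
have eS : (S + i c = q r + i r)%N by rewrite -qS; apply: sum_block_fun.
have -> : block_exp s i r.+1 = (block_exp s i r + (R * i (s r) + (i r + i (s r)) * S))%N.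
  rewrite /block_exp big_nat_recr //=; congr addn; rewrite big_split /=; congr addn.
    by rewrite /R big_distrl; apply: eq_bigr => a _; rewrite mulnA.
  by rewrite /S big_distrr.
rewrite qS big_mkcond big_nat_recr //= -big_mkcond /=.
(* If [r] moves to [r.+1], no earlier value is larger, so no inversion is created. *)
have [e|e] := hs r (ltnSn r).
  have R0 : R = 0%N.
    rewrite /R big_nat_cond big1 // => a /andP[/andP[_ ar] _].
    by rewrite e ltnNge (leq_trans (block_fun_le hs' ar)) // leqW.
  rewrite R0 e eqxx /= -/c in IH *.
  move: IH (congr1 odd eS); rewrite !(oddD, oddM) /=.
  do !move: (odd _); by do !case.
(* If [r] closes the interval, the earlier values above [c] are exactly [c.+1, ..., r]. *)
have eR : (R + (q c + i c) = q r + i r)%N.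
  have := sum_block_fun (fun u => (c < u)%N * i u)%N hs'.
  rewrite -/c ltnn addn0 /R e => ->; rewrite -!qS /q.
  rewrite (big_cat_nat (n := c.+1)) //=; last by rewrite ltnS block_start_le.
  rewrite [in RHS](big_cat_nat (n := c.+1)) //=; last by rewrite ltnS block_start_le.
  rewrite [RHS]addnC; congr addn; rewrite big_nat_cond [X in (X + _)%N]big1 ?add0n.
    rewrite big_nat_cond [RHS]big_nat_cond; apply: eq_bigr => u /andP[/andP[cu _] _].
    by rewrite cu mul1n.
  by move=> u /andP[/andP[_ uc] _]; rewrite ltnNge -ltnS uc.
rewrite (block_fun_closing e) /= e -/c in IH *.
move: IH (congr1 odd eS) (congr1 odd eR); rewrite !(oddD, oddM) /= !qS !oddD.
do !move: (odd _); by do !case.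
Qed.

(** Earlier values fill [[0, k]] except for the start of the open interval, so by injectivity a
    value at most [k] must be that start. *)
Lemma hess_block_fun r (s : 'S_r.+1) :
  hess_from 0 s -> block_fun (fun k => s (inord k)) r.+1.
Proof.
move=> /forallP hs k; elim/ltn_ind: k => k IH kr; set sn := (fun k => _).
have hsk : (sn k <= k.+1)%N by have := hs (inord k); rewrite /= inordK.
move: hsk; rewrite leq_eqVlt => /orP[/eqP|]; first by left.
rewrite ltnS => skk; right; apply/esym/eqP.
have bk : block_fun sn k by move=> a ak; apply: IH => //; apply: ltn_trans kr.
have := sum_block_fun (fun u => (u == sn k) : nat) bk.
rewrite big_nat_cond big1 ?add0n => [|a /andP[/andP[_ ak] _]]; last first.
  rewrite /sn (inj_eq val_inj) (inj_eq perm_inj) -val_eqE /= !inordK //.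
    by rewrite ltn_eqF.
  exact: ltn_trans kr.
rewrite (bigD1_seq (sn k)) ?mem_index_iota ?iota_uniq //= eqxx.
by case: eqP.
Qed.

Lemma prod_sign_nat (A : pzRingType) (l : seq nat) (e : nat -> nat) (y : nat -> A) :
  \prod_(a <- l) ((-1) ^+ e a * y a) = (-1) ^+ (\sum_(a <- l) e a)%N * \prod_(a <- l) y a.
Proof.
elim: l => [|a l IH]; first by rewrite !big_nil mulr1.
rewrite !big_cons IH exprD -!mulrA; congr (_ * _); rewrite !mulrA; congr (_ * _).
exact: commr_sign.
Qed.

(** * Summing out a multi-index one entry at a time *)

Section Recr.
Variables (N : nat).

Definition irec k (I : idx N k) (i : 'I_N) : idx N k.+1 :=
  [ffun a => if unlift ord_max a is Some b then I b else i].

Lemma irec_max k (I : idx N k) i : irec I i ord_max = i.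
Proof. by rewrite ffunE unlift_none. Qed.

Lemma irec_inord k (I : idx N k.+1) i a : (a < k.+1)%N ->
  irec I i (inord a) = I (inord a).
Proof.
move=> ak; have -> : inord a = lift ord_max (inord a : 'I_k.+1).
  by apply/val_inj; rewrite /= /bump inordK ?(leqW ak) // inordK // leqNgt ak.
by rewrite ffunE liftK.
Qed.

Lemma sum_irec k (V : nmodType) (F : idx N k.+1 -> V) :
  \sum_I F I = \sum_(I : idx N k) \sum_i F (irec I i).
Proof.
rewrite pair_bigA /=.
rewrite (reindex (fun p : idx N k * 'I_N => irec p.1 p.2)) //=.
exists (fun I : idx N k.+1 => ([ffun b => I (lift ord_max b)], I ord_max)) => [[I i]|I] _ /=.
  rewrite irec_max; congr (_, _); apply/ffunP => b; rewrite !ffunE liftK //.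
by apply/ffunP => a; rewrite ffunE; case: unliftP => [b ->|->] //; rewrite ffunE.
Qed.
End Recr.

Lemma sum_mx1 (A : pzRingType) N (j : 'I_N) (y : 'I_N -> A) :
  \sum_l (1 : 'M[A]_N) j l * y l = y j.
Proof.
rewrite (bigD1 j) //= [X in _ + X]big1 ?addr0 => [|l /negPf nl].
  by rewrite mxE eqxx mul1r.
by rewrite mxE eq_sym nl mul0r.
Qed.

Section Transfer.
Variables (m N : nat) (A : algType algC) (x : 'I_N -> 'I_N -> A).

Definition Xtr : 'M[A]_N := \matrix_(i, j) x j i.

(** This is what summing out indices produces directly; [gamE] identifies it with [gam] for positive
    exponents. *)
Definition trgam (k : nat) : A := \sum_j (-1) ^+ par m j * (Xtr ^+ k) j j.

Lemma trgamS k :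
  \sum_j \sum_l (Xtr ^+ k) j l * ((-1) ^+ par m j * x j l) = trgam k.+1.
Proof.
apply: eq_bigr => j _; rewrite exprSr mxE mulr_sumr; apply: eq_bigr => l _.
by rewrite !mxE mulrA commr_sign mulrA.
Qed.

Variable (s : nat -> nat).

(** The sign of a Hessenberg term, distributed over positions: each closing position carries the
    parity at the start of its interval. *)
Definition block_factor (k : nat) (I : nat -> 'I_N) : A :=
  (-1) ^+ (if s k == k.+1 then 0%N else par m (I (s k))) * x (I (s k)) (I k).

(** An interval is charged to its last position [k]; it starts at [s k], so its length is
    [(k - s k).+1]. *)
Definition block_gam (k : nat) : A :=
  if s k == k.+1 then 1 else trgam (k - s k).+1.

Lemma block_factor_ext k I I' : I (s k) = I' (s k) -> I k = I' k ->
  block_factor k I = block_factor k I'.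
Proof. by rewrite /block_factor => -> ->. Qed.

(* [g] is the not yet summed dependence on the two ends of the open interval. *)
Lemma transfer k : block_fun s k.+1 -> forall g : 'I_N -> 'I_N -> A,
  \sum_(I : idx N k.+1)
     (\prod_(0 <= a < k) block_factor a (fun u => I (inord u)))
     * g (I (inord (block_start s k))) (I (inord k))
  = (\prod_(0 <= a < k) block_gam a)
    * \sum_j \sum_l (Xtr ^+ (k - block_start s k)) j l * g j l.
Proof.
elim: k => [|k IH] hs g.
  rewrite !big_nil mul1r (reindex (fun i : 'I_N => [ffun=> i] : idx N 1)) /=; last first.
    exists (fun I : idx N 1 => I ord0) => [i|I] _; rewrite ?ffunE //.
    by apply/ffunP => a; rewrite ffunE (ord1 a).
  by apply: eq_bigr => j _; rewrite big_nil mul1r !ffunE subnn expr0 sum_mx1.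
have hs' : block_fun s k.+1 by move=> a ak; apply: hs; apply: ltnW.
rewrite sum_irec [in RHS]big_nat_recr //=.
set c := block_start s k.
have ck : (c < k.+1)%N by rewrite ltnS block_start_le.
have prodE (I : idx N k.+1) i :
    \prod_(0 <= a < k) block_factor a (fun u => irec I i (inord u))
    = \prod_(0 <= a < k) block_factor a (fun u => I (inord u)).
  apply: eq_big_nat => a /andP[_ ak]; apply: block_factor_ext.
    by rewrite irec_inord // ltnS (leq_trans (block_fun_le hs' (ltnW ak))).
  by rewrite irec_inord // ltnW.
have imax (I : idx N k.+1) i : irec I i (inord k.+1) = i.
  by rewrite -[RHS](irec_max I i); congr fun_of_fin; apply/val_inj; rewrite /= inordK.
have [e|e] := hs' k (ltnSn k).
  (* The interval continues: the new factor [x i l] is the entry [(l, i)] of [Xtr], and absorbing it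
     into [g] raises the matrix power by one. *)
  rewrite {2}/block_gam e eqxx mulr1 -/c.
  transitivity (\sum_(I : idx N k.+1) (\prod_(0 <= a < k) block_factor a (fun u => I (inord u)))
      * \sum_i x i (I (inord k)) * g (I (inord c)) i).
    apply: eq_bigr => I _; rewrite mulr_sumr; apply: eq_bigr => i _.
    rewrite big_nat_recr //= prodE -mulrA; congr (_ * _).
    by rewrite /block_factor e eqxx expr0 mul1r imax !irec_inord.
  rewrite (IH hs' (fun j l => \sum_i x i l * g j i)) -/c; congr (_ * _).
  apply: eq_bigr => j _; rewrite subSn // exprSr.
  under [LHS]eq_bigr do rewrite mulr_sumr.
  rewrite exchange_big /=; apply: eq_bigr => i _; rewrite mxE mulr_suml.
  by apply: eq_bigr => l _; rewrite !mxE mulrA.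
(* The interval closes into a supertrace, and the next one opens with both ends at the new index,
   whence [g i i]. *)
rewrite {2}/block_gam (block_fun_closing e) e -/c subnn expr0.
transitivity (\sum_(I : idx N k.+1) (\prod_(0 <= a < k) block_factor a (fun u => I (inord u)))
      * ((-1) ^+ par m (I (inord c)) * x (I (inord c)) (I (inord k)) * \sum_i g i i)).
  apply: eq_bigr => I _; rewrite !mulr_sumr; apply: eq_bigr => i _.
  rewrite big_nat_recr //= prodE -mulrA; congr (_ * _).
  by rewrite /block_factor (block_fun_closing e) e -/c imax !irec_inord.
rewrite (IH hs' (fun j l => (-1) ^+ par m j * x j l * \sum_i g i i)) -/c.
rewrite -mulrA; congr (_ * _).
have -> : \sum_j \sum_l (1 : 'M[A]_N) j l * g j l = \sum_i g i i.
  by apply: eq_bigr => j _; rewrite sum_mx1.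
rewrite -trgamS !mulr_suml; apply: eq_bigr => j _; rewrite mulr_suml.
by apply: eq_bigr => l _; rewrite -!mulrA.
Qed.
End Transfer.

(** * Factorization of the supertrace of a Hessenberg permutation *)

Lemma sum_ltn_nat n (f : nat -> nat -> nat) :
  (\sum_(a < n) \sum_(b < n | (a < b)%N) f a b = \sum_(0 <= b < n) \sum_(0 <= a < b) f a b)%N.
Proof.
rewrite (exchange_big_dep xpredT) //= big_mkord; apply: eq_bigr => b _.
by rewrite big_mkord (big_ord_widen n (fun a => f a b)) // ltnW.
Qed.

Section HessenbergTerms.
Variables (m N r : nat) (A : algType algC) (x : 'I_N -> 'I_N -> A).
Variable s : 'S_r.+1.
Hypothesis hs : hess_from 0 s.
Let sn (k : nat) : nat := s (inord k).

Lemma hess_last : sn r = block_start sn r.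
Proof.
have [e|//] := hess_block_fun hs (ltnSn r).
by have := ltn_ord (s (inord r)); rewrite {1}e ltnn.
Qed.

(** Only the parity at the start of each interval survives, which is the supertrace sign of that
    interval. *)
Lemma odd_term_exp_hess (I : idx N r.+1) :
  odd (term_exp m s I)
  = odd (\sum_(0 <= a < r.+1)
           (if sn a == a.+1 then 0 else par m (I (inord (sn a)))))%N.
Proof.
pose i u := par m (I (inord u)).
have -> : term_exp m s I = (\sum_(0 <= u < r.+1) i u + block_exp sn i r.+1)%N.
  rewrite /term_exp /block_exp; congr addn.
    by rewrite big_mkord; apply: eq_bigr => a _; rewrite /i inord_val.
  rewrite -(sum_ltn_nat r.+1 (fun a b =>
    (sn b < sn a)%N * (i (sn a) * i (sn b)) + (i b + i (sn b)) * i (sn a))%N).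
  apply: eq_bigr => a _; apply: eq_bigr => b _.
  by rewrite /i /sn !inord_val.
rewrite (odd_block_exp i (hess_block_fun hs)) -/sn.
have -> : block_start sn r.+1 = r.+1 by rewrite /= (block_fun_closing hess_last).
rewrite -!addnA addnn !addnA oddD odd_double addbF -addnA oddD oddD oddM andbb addbb addbF.
by rewrite big_mkcond /=; congr odd; apply: eq_bigr => a _; case: eqP.
Qed.

Lemma sum_term_hess :
  \sum_I term m x s I
  = \prod_(i < r.+1) (if s i == i.+1 :> nat then 1 else trgam m x (i - s i).+1).
Proof.
have last := hess_last.
transitivity (\sum_(I : idx N r.+1)
    (\prod_(0 <= a < r) block_factor m x sn a (fun u => I (inord u)))
    * ((-1) ^+ par m (I (inord (block_start sn r)))
       * x (I (inord (block_start sn r))) (I (inord r)))).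
  apply: eq_bigr => I _; rewrite /term.
  rewrite (sign_congr _ (odd_term_exp_hess I)).
  transitivity (\prod_(0 <= a < r.+1) block_factor m x sn a (fun u => I (inord u))).
    rewrite /block_factor prod_sign_nat; congr (_ * _).
    by rewrite big_mkord; apply: eq_bigr => a _; rewrite /sn !inord_val.
  by rewrite big_nat_recr //= {2}/block_factor (block_fun_closing last) last.
rewrite (transfer m x (hess_block_fun hs)
  (fun j l => (-1) ^+ par m j * x j l)) trgamS.
transitivity (\prod_(0 <= a < r.+1) block_gam m x sn a).
  by rewrite big_nat_recr //= {3}/block_gam (block_fun_closing last) last.
by rewrite big_mkord; apply: eq_bigr => a _; rewrite /block_gam /sn inord_val.
Qed.
End HessenbergTerms.

(** * Star powers as powers of the transpose *)

Lemma sum_ltn2 (F : 'I_2 -> 'I_2 -> nat) :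
  (\sum_(a < 2) \sum_(b < 2 | (a < b)%N) F a b = F ord0 1%R)%N.
Proof.
rewrite !big_ord_recl big_ord0 addn0 big_mkcond [X in (_ + X)%N]big_mkcond /=.
rewrite !big_ord_recl !big_ord0 /= !addn0 add0n; congr F; exact: val_inj.
Qed.

Section Powers.
Variables (m N : nat) (A : algType algC) (x : 'I_N -> 'I_N -> A).
Hypothesis hx : forall i j k l : 'I_N,
  x i j * x k l = (-1) ^+ (pe m i j * pe m k l)%N * (x k l * x i j).

(** The deltas in [PT], [Y1] and [Z2] force the intermediate indices [pair2 i l] and [pair2 l l];
    what remains is a signed matrix product. *)
Lemma sstarE (Y Z : smat A N) i j :
  sstar m Y Z i j =
  \sum_l (-1) ^+ (pe m i l * pe m l j)%N * (Y i l * Z l j).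
Proof.
rewrite /sstar; apply: eq_bigr => l _.
have p0 (a b : 'I_N) : pair2 a b ord0 = a by rewrite ffunE.
have p1 (a b : 'I_N) : pair2 a b 1 = b by rewrite ffunE.
have pP (J : idx N 2) : J = pair2 (J ord0) (J 1).
  apply/ffunP => a; rewrite ffunE; case: eqP => [->//|/eqP].
  by case: a => [[|[|]]] // h _; congr (J _); apply/val_inj.
rewrite {1}/tmul (bigD1 (pair2 l l)) //= [X in _ + X]big1 ?addr0; last first.
  move=> J neJ; rewrite /Z2 p0 p1; case: ifP => [/eqP e0|]; last by rewrite !mulr0.
  rewrite /tmul big1 ?mul0r ?mulr0 // => K _.
  rewrite /PT /Y1 p0 p1; case: ifP => [/andP[/eqP e1 /eqP e2]|]; last by rewrite mul0r mulr0.
  case: ifP => [/eqP e3|]; last by rewrite !mulr0.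
  by case/eqP: neJ; rewrite [J]pP e0 -e3 -e1.
rewrite {1}/tmul (bigD1 (pair2 i l)) //= [X in _ + X]big1 ?addr0; last first.
  move=> J neJ; rewrite /PT !p0 !p1; case: ifP => [/andP[/eqP e1 /eqP e2]|]; last by rewrite mul0r mulr0.
  by case/eqP: neJ; rewrite [J]pP -e1 -e2.
rewrite /PT /Y1 /Z2 !p0 !p1 !eqxx /= !mulrA.
rewrite -!exprD; congr (_ * _ * _); apply: sign_congr.
rewrite /tsign !sum_ltn2 !big_ord_recl !big_ord0 !ffunE /=.
rewrite !(oddD, oddM, odd_pe) /=.
by case: (odd (par m i)); case: (odd (par m j)); case: (odd (par m l)).
Qed.

(** Parities telescope along a path of indices, so an entry of a power supercommutes with generators
    as the generator [x i l] does. *)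
Lemma Xtr_comm k (i l a b : 'I_N) :
  (Xtr x ^+ k) l i * x a b
  = (-1) ^+ (pe m i l * pe m a b)%N * (x a b * (Xtr x ^+ k) l i).
Proof.
elim: k l => [|k IH] l.
  rewrite expr0 mxE; case: eqP => [->|_]; last by rewrite mulr0n !(mulr0, mul0r).
  rewrite mulr1n mul1r mulr1 -[RHS]mul1r -[1 in RHS](expr0 (-1 : A)) mulrA -exprD.
  by rewrite -signr_odd oddM odd_pe_id mul1r.
rewrite exprS mxE mulr_suml !mulr_sumr; apply: eq_bigr => p _.
rewrite mxE -mulrA IH !mulrA commr_sign -!mulrA [x p l * (_ * _)]mulrA hx !mulrA.
rewrite -exprD; congr (_ * _ * _ * _); apply: sign_congr.
rewrite !(oddD, oddM, odd_pe).
by do !move: (odd _); do !case.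
Qed.

(* Supercommutativity absorbs the sign of the * product, but reverses the order of
   the factors; hence the transpose. *)
Lemma XpowE k i j : Xpow m x k i j = (Xtr x ^+ k.+1) j i.
Proof.
elim: k i j => [|k IH] i j; first by rewrite expr1 mxE.
rewrite [LHS]/= sstarE exprS mxE; apply: eq_bigr => l _.
rewrite IH Xtr_comm mulrA -exprD addnn -mul2n exprM sqrrN expr1n expr1n mul1r mxE //.
Qed.

Lemma gamE k : gam m x k.+1 = trgam m x k.+1.
Proof. by rewrite /gam /sstr /trgam /=; apply: eq_bigr => i _; rewrite XpowE. Qed.
End Powers.

(** * Immanants *)

Section Immanants.
Variables (m N : nat) (A : algType algC) (x : 'I_N -> 'I_N -> A).
Hypothesis hx : forall i j k l : 'I_N,
  x i j * x k l = (-1) ^+ (pe m i j * pe m k l)%N * (x k l * x i j).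

Lemma superImm_ipre k (chi : 'S_k -> algC) (I : idx N k) (t : 'S_k) :
  (forall s u, chi (s ^ u)%g = chi s) ->
  superImm m x chi (ipre I t) = superImm m x chi I.
Proof.
move=> chiJ; rewrite !superImmE (reindex_inj (conjg_inj t)) /=.
by apply: eq_bigr => s _; rewrite chiJ term_conj.
Qed.

Lemma prod_Gamma r (s : 'S_r) :
  \prod_(i < r) Gamma m x r i (s i)
  = if hess_from 0 s then
      (\prod_(i < r) (if s i == i.+1 :> nat then 1 else trgam m x (i - s i).+1))
        *+ hess_weight 0 s
    else 0.
Proof.
case: ifPn => [/forallP hs|]; last first.
  rewrite negb_forall => /existsP[i]; rewrite implyTb -ltnNge => si.
  suff z : Gamma m x r i (s i) = 0.
    by elim: (index_enum _) (mem_index_enum i) => // j l IH;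
       rewrite inE big_cons => /orP[/eqP <-|/IH->]; rewrite ?z ?mul0r ?mulr0.
  by rewrite mxE leqNgt (ltnW si) /= gtn_eqF.
rewrite /hess_weight [X in _ *+ X]big_mkcond -prodrMn; apply: eq_bigr => i _; rewrite mxE /=.
have := hs i; rewrite /= leq_eqVlt ltnS; case: eqP => [->|_] /=.
  by rewrite ltnn.
by move=> le; rewrite le mulr1n addn1 gamE.
Qed.

Lemma sum_superImm r (chi : 'S_r.+1 -> algC) :
  (forall s u, chi (s ^ u)%g = chi s) ->
  \sum_I superImm m x chi I = immanant chi (Gamma m x r.+1).
Proof.
move=> chiJ; pose F s := chi s *: \sum_(I : idx N r.+1) term m x s I.
(* Conjugation of [s] is undone by relabelling the summation index [I]. *)
have FJ s t : F (s ^ t)%g = F s.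
  rewrite /F chiJ (reindex_inj (@ipre_inj N _ t)); congr (_ *: _).
  by apply: eq_bigr => I _; rewrite term_conj.
transitivity (\sum_s F s).
  under eq_bigr do rewrite superImmE.
  by rewrite exchange_big; apply: eq_bigr => s _; rewrite -scaler_sumr.
rewrite (sum_hess FJ) big_mkcond; apply: eq_bigr => s _; rewrite prod_Gamma.
case: ifP => hs; last by rewrite scaler0.
by rewrite /F sum_term_hess // scalerMnr.
Qed.
End Immanants.

Theorem theorem3p11 (m n r : nat) (A : algType algC)
  (x : 'I_(m + n) -> 'I_(m + n) -> A)
  (hx : forall i j k l : 'I_(m + n),
      x i j * x k l = (-1) ^+ (pe m i j * pe m k l)%N * (x k l * x i j))
  (hr : (0 < r)%N) (lam : Iirr [set: 'S_r]) :
  \sum_(I : idx (m + n) r | nondecr I)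
      ((alpha I)%:R : algC)^-1 *: superImm m x (fun s => 'chi_lam s) I
  = ((r`!)%:R : algC)^-1 *: immanant (fun s => 'chi_lam s) (Gamma m x r).
Proof.
have chiJ (s u : 'S_r) : 'chi_lam (s ^ u)%g = 'chi_lam s by rewrite cfunJ ?inE.
rewrite sum_nondecr => [|I t]; last exact: superImm_ipre.
by case: r hr lam chiJ => // r _ lam chiJ; rewrite sum_superImm.
Qed.
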